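(* Let $k\subset K$ be a field extension, $A\subset M_n(K)$ a $k$-algebra, and let $E=\operatorname{Span}_K\{e_1,\dots,e_m\}\in G_A(m,n)(K)$. Suppose $K^n=E\oplus L$ as a $K$-module for some $K$-submodule $L$ of $K^n$. Then the Zariski tangent space to $\mathbb{G}_A(m,n)$ at the $K$-rational point $E$ is isomorphic (as a $K$-vector space) to $$S_E=\{\psi\in\operatorname{Hom}_K(E,L)\mid \operatorname{im} d(\psi)\subset\textstyle\bigwedge_A^m\}.$$
   Context: Elements of $R^n$ ($R$ a commutative $K$-algebra) are row vectors and $A\subset M_n(K)$ acts by right multiplication; $e_1,\dots,e_n$ are the standard unit vectors; a submodule $M\subset R^n$ is $A$-invariant if $Ma\subset M$ for all $a\in A$. $G(m,n)(R)$ is the set of free rank $m$ direct summands of $R^n$, functorial in $R$ by pullback (for $\delta:R\to T$, $M$ goes to the image of $T\otimes_RM$ in $T^n$). $M\in G(m,n)(R)$ is generated by $A$-invariants if the image of $\bigwedge^mM$ in $\bigwedge^mR^n\cong R\otimes_K\bigwedge^mK^n$ has an $R$-module generator of the form $\sum_i r_i\otimes v_{i1}\wedge\cdots\wedge v_{im}$ where, for every $i$, $\{v_{i1},\dots,v_{im}\}$ is a basis of a rank $m$ $A$-invariant subspace of $K^n$. $G_A(m,n)(R)$ is the set of $M\in G(m,n)(R)$ generated by $A$-invariants, and $\mathbb{G}_A(m,n)$ is the scheme representing $G_A(m,n)$. $\bigwedge_A^m\subset\bigwedge^mK^n$ is the $K$-span of all $v_1\wedge\cdots\wedge v_m$ with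 $v_1,\dots,v_m$ a basis of an $A$-invariant subspace of $K^n$. The Zariski tangent space at $E$ is $T_E=\{M\in G_A(m,n)(K[\epsilon]/(\epsilon^2))\mid \Psi(M)=E\}$, where $\Psi:G_A(m,n)(K[\epsilon]/(\epsilon^2))\to G_A(m,n)(K)$ is induced by $\epsilon\mapsto 0$. Its vector space structure: if $M$ has basis $\{e_i+\epsilon f_i\}_{i=1}^m$ and $M'$ has basis $\{e_i+\epsilon g_i\}_{i=1}^m$ with $f_i,g_i\in K^n$, and $a,b\in K$, then $aM+bM'$ is the family with basis $\{e_i+\epsilon(af_i+bg_i)\}_{i=1}^m$. The $K$-linear map $d:\operatorname{Hom}_K(E,K^n)\to\operatorname{Hom}_K(\bigwedge^mE,\bigwedge^mK^n)$ is given by $d(\psi)(e_1\wedge\cdots\wedge e_m)=\sum_{i=1}^m e_1\wedge\cdots\wedge e_{i-1}\wedge\psi(e_i)\wedge e_{i+1}\wedge\cdots\wedge e_m$; elements of $\operatorname{Hom}_K(E,L)$ are viewed in $\operatorname{Hom}_K(E,K^n)$ via $L\subset K^n$. *)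

(* Defs.v *)
From HB Require Import structures.
From mathcomp Require Import all_boot all_order all_algebra.
From mathcomp Require Import boolp classical_sets.

Set Implicit Arguments.
Unset Strict Implicit.
Unset Printing Implicit Defensive.

Import GRing.Theory.
Local Open Scope classical_set_scope.
Local Open Scope ring_scope.

Section Span.
Variables (R : nzRingType) (V : lmodType R).

Definition is_submodule (M : set V) : Prop :=
  M 0 /\ forall (a : R) u v, M u -> M v -> M (a *: u + v).

Definition lspan (X : set V) : set V :=
  [set v | exists s : seq (R * V),
     (forall p, p \in s -> X p.2) /\ v = \sum_(p <- s) p.1 *: p.2].

Lemma lspan0 X : lspan X 0.
Proof. by exists [::]; rewrite big_nil. Qed.

Lemma lspanP X a u v : lspan X u -> lspan X v -> lspan X (a *: u + v).
Proof.
move=> [s [sX ->]] [t [tX ->]]; exists ([seq (a * p.1, p.2) | p <- s] ++ t).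
split=> [p|]; first by rewrite mem_cat => /orP[/mapP[q /sX qX ->]|/tX].
by rewrite big_cat big_map scaler_sumr; congr (_ + _); apply: eq_bigr => p _;
  rewrite scalerA.
Qed.

Lemma lspan_gen X v : X v -> lspan X v.
Proof.
move=> Xv; exists [:: (1, v)]; rewrite big_seq1 scale1r; split=> // p.
by rewrite inE => /eqP->.
Qed.

Lemma lspanZ X a u : lspan X u -> lspan X (a *: u).
Proof. by move=> Xu; rewrite -[_ *: _]addr0; apply: lspanP (lspan0 _). Qed.

Lemma lspanD X u v : lspan X u -> lspan X v -> lspan X (u + v).
Proof. by move=> Xu Xv; rewrite -[u]scale1r; apply: lspanP. Qed.

Lemma lspan_sum X I (r : seq I) (F : I -> V) :
  (forall i, lspan X (F i)) -> lspan X (\sum_(i <- r) F i).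
Proof. by move=> XF; apply: big_ind => // [|u v]; [apply: lspan0|apply: lspanD]. Qed.

Lemma lspan_min X (M : set V) : is_submodule M -> X `<=` M -> lspan X `<=` M.
Proof.
move=> [M0 MP] XM _ [s [sX ->]]; elim: s sX => [|p s IH] sX; first by rewrite big_nil.
rewrite big_cons; apply: MP; first by apply/XM/sX; rewrite mem_head.
by apply: IH => q qs; apply: sX; rewrite inE qs orbT.
Qed.

End Span.

(* The exterior power in coordinates: the free module on the m-subsets of
   {0, .., n-1}, the I-coordinate of v_1 /\ ... /\ v_m being the minor with
   columns I (in increasing order) of the matrix with rows v_1, ..., v_m. *)
Definition msubset (m n : nat) : predArgType := {I : {set 'I_n} | #|I| == m}.

HB.instance Definition _ m n := Finite.on (msubset m n).

Definition msubset_nth m n (I : msubset m n) (i : 'I_m) : 'I_n :=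
  enum_val (cast_ord (esym (eqP (valP I))) i).

Notation ext R m n := 'rV[R]_#|msubset m n|.

Definition wedge (R : comNzRingType) (m n : nat) (v : 'M[R]_(m, n)) : ext R m n :=
  \row_(I < #|msubset m n|) \det (colsub (msubset_nth (enum_val I)) v).

(* The value on e_1 /\ ... /\ e_m of the derivation of exterior powers sending
   e_i to f_i: \sum_i e_1 /\ ... /\ e_(i-1) /\ f_i /\ e_(i+1) /\ ... /\ e_m. *)
Definition dwedge (R : comNzRingType) (m n : nat) (e f : 'M[R]_(m, n)) : ext R m n :=
  \sum_(i < m) wedge (\matrix_(j < m) (if j == i then row j f else row j e)).

(* A is a unital k-subalgebra of M_n(K), K being an extension of k via iota. *)
Definition is_subalgebra (k K : fieldType) (iota : {rmorphism k -> K}) (n : nat)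
    (A : set 'M[K]_n) : Prop :=
  [/\ A 1%:M,
      forall (c : k) a b, A a -> A b -> A (iota c *: a + b)
    & forall a b, A a -> A b -> A (a *m b)].

Section Grassmannian.
Variables (K : fieldType) (m n : nat).

Section OverR.
Variable R : comAlgType K.

(* The rows of B form an R-basis of M. *)
Definition is_basis (B : 'M[R]_(m, n)) (M : set 'rV[R]_n) : Prop :=
  injective (fun c : 'rV[R]_m => c *m B) /\ M = range (fun c : 'rV[R]_m => c *m B).

Definition Gr (M : set 'rV[R]_n) : Prop :=
  (exists B, is_basis B M) /\
  exists N : set 'rV[R]_n,
    [/\ is_submodule N, forall x, M x -> N x -> x = 0
      & forall x, exists u v, [/\ M u, N v & x = u + v]].

Definition ext_image (M : set 'rV[R]_n) : set (ext R m n) :=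
  lspan [set w | exists v : 'M[R]_(m, n), (forall i, M (row i v)) /\ w = wedge v].

(* The rows of v form a basis of an A-invariant subspace of K^n. *)
Definition inv_basis (A : set 'M[K]_n) (v : 'M[K]_(m, n)) : Prop :=
  row_free v /\ forall a, A a -> stablemx v a.

Definition generated_by_invariants (A : set 'M[K]_n) (M : set 'rV[R]_n) : Prop :=
  exists s : seq (R * 'M[K]_(m, n)),
    (forall p, p \in s -> inv_basis A p.2) /\
    ext_image M =
      range (fun r : R => r *: \sum_(p <- s) p.1 *: map_mx (in_alg R) (wedge p.2)).

Definition GrA (A : set 'M[K]_n) (M : set 'rV[R]_n) : Prop :=
  Gr M /\ generated_by_invariants A M.

End OverR.

Definition pullback (R T : comAlgType K) (delta : {lrmorphism R -> T})
  (M : set 'rV[R]_n) : set 'rV[T]_n := lspan (map_mx delta @` M).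

Definition ext_inv (A : set 'M[K]_n) : set (ext K m n) :=
  lspan [set w | exists v, inv_basis A v /\ w = wedge v].

End Grassmannian.

Section DualNumbers.
Variable K : fieldType.

Definition dual := {poly %/ ('X^2 : {poly K})}.
HB.instance Definition _ := GRing.ComUnitAlgebra.on dual.

Definition eps : dual := 'qX.

Definition eps0 (x : dual) : K^o := (x : {poly K}).[0].

Lemma mk_monicX2 : mk_monic 'X^2 = 'X^2 :> {poly K}.
Proof. by rewrite /mk_monic size_polyXn monicXn. Qed.

Lemma dual_mulE (x y : dual) :
  (x * y : dual) = Pdiv.CommonRing.rmodp ((x : {poly K}) * y) 'X^2 :> {poly K}.
Proof. exact: (congr1 (Pdiv.CommonRing.rmodp _) mk_monicX2). Qed.

Lemma epsE : eps = 'X :> {poly K}.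
Proof. by apply: in_qpoly_small; rewrite mk_monicX2 size_polyX size_polyXn. Qed.

Lemma eps_simplE :
  Pdiv.CommonRing.rmodp 'X (mk_monic 'X^2) = 'X :> {poly K}.
Proof. exact: epsE. Qed.

Fact eps0_zmod : zmod_morphism eps0.
Proof. by move=> x y; rewrite /eps0 /= hornerD hornerN. Qed.
HB.instance Definition _ := GRing.isZmodMorphism.Build dual K^o eps0 eps0_zmod.

Fact eps0_monoid : monoid_morphism eps0.
Proof.
split; first by rewrite /eps0 /= hornerC.
move=> x y; rewrite /eps0 dual_mulE -hornerM.
have := Pdiv.RingMonic.rdivp_eq (monicXn K 2) ((x : {poly K}) * y).
by move=> {2}->; rewrite hornerD hornerM hornerXn expr0n mulr0 add0r.
Qed.
HB.instance Definition _ := GRing.isMonoidMorphism.Build dual K^o eps0 eps0_monoid.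

Fact eps0_scalable : scalable eps0.
Proof. by move=> a x; rewrite /eps0 /= hornerZ. Qed.
HB.instance Definition _ := GRing.isScalable.Build K dual K^o *:%R eps0 eps0_scalable.

End DualNumbers.
Arguments eps {K}.
Arguments eps0 {K}.

Section Frame.
Variables (R : comNzRingType) (m n : nat) (hmn : (m <= n)%N).

Definition std_frame : 'M[R]_(m, n) := \matrix_(i < m) delta_mx 0 (widen_ord hmn i).

End Frame.
Arguments std_frame R {m n}.

Section DualCoordinates.
Variable K : fieldType.
Local Notation D := (dual K).

Definition eps1 (x : D) : K := (x : {poly K})`_1.

Lemma epsK : eps * eps = 0 :> D.
Proof.
apply/val_inj; rewrite [LHS]dual_mulE !epsE -expr2; exact: Pdiv.RingMonic.rmodpp (monicXn K 2).
Qed.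

Lemma eps0E (x : D) : eps0 x = (x : {poly K})`_0.
Proof. exact: horner_coef0. Qed.

Lemma dual_eq (x : D) : x = (eps0 x)%:A + eps * (eps1 x)%:A.
Proof.
apply/val_inj; rewrite mulr_algr /= eps_simplE eps0E /eps1; apply/polyP=> i.
have sx : (size (x : {poly K}) <= 2)%N.
  have sm : size (mk_monic ('X^2 : {poly K})) = 3%N by rewrite mk_monicX2 size_polyXn.
  by rewrite -ltnS -sm size_mk_monic.
rewrite coefD !coefZ coefC coefX; case: i => [|[|i]] /=; rewrite ?mulr1 ?mulr0 ?addr0 ?add0r//.
by rewrite nth_default// (leq_trans sx).
Qed.

Lemma eps0C a : eps0 (a%:A : D) = a.
Proof. by rewrite eps0E /= coefZ coefC mulr1. Qed.

Lemma eps0eps : eps0 (eps : D) = 0.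
Proof. by rewrite eps0E /= eps_simplE coefX. Qed.

Fact eps1_linear : scalar eps1.
Proof. by move=> a x y; rewrite /eps1 /= coefD coefZ. Qed.
HB.instance Definition _ := GRing.isLinear.Build K D K *%R eps1 eps1_linear.

Lemma eps1C a : eps1 (a%:A : D) = 0.
Proof. by rewrite /eps1 /= coefZ coefC mulr0. Qed.

Lemma eps1epsC a : eps1 (eps * a%:A : D) = a.
Proof. by rewrite mulr_algr /eps1 /= eps_simplE coefZ coefX mulr1. Qed.

Lemma dual_mul (a b c d : K) :
  (a%:A + eps * b%:A) * (c%:A + eps * d%:A) =
  (a * c)%:A + eps * (a * d + b * c)%:A :> D.
Proof.
have scM (x y : K) : (x * y)%:A = x%:A * y%:A :> D by rewrite mulr_algl scalerA.
rewrite scalerDl !scM mulrDl !mulrDr -!addrA; congr (_ + _).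
by rewrite [X in _ + (_ + X)]mulrACA epsK mul0r addr0 mulrCA !mulrA.
Qed.

End DualCoordinates.

Section WedgeTheory.
Variable R : comNzRingType.

Lemma wedgeM m n (P : 'M[R]_m) (B : 'M[R]_(m, n)) :
  wedge (P *m B) = \det P *: wedge B.
Proof.
apply/rowP=> I; rewrite !mxE -det_mulmx; congr (\det _).
by apply/matrixP=> i j; rewrite !mxE; apply: eq_bigr => k _; rewrite mxE.
Qed.

Lemma map_wedge (S : comNzRingType) (f : {rmorphism R -> S}) m n (B : 'M[R]_(m, n)) :
  map_mx f (wedge B) = wedge (map_mx f B).
Proof.
apply/rowP=> I; rewrite !mxE -det_map_mx; congr (\det _).
by apply/matrixP=> i j; rewrite !mxE.
Qed.

Lemma dwedge_linear m n (e : 'M[R]_(m, n)) : linear (dwedge e).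
Proof.
move=> a f g; rewrite /dwedge scaler_sumr -big_split; apply: eq_bigr => i _.
apply/rowP=> I; rewrite !mxE -[X in _ = _ + X]mul1r.
apply: (determinant_multilinear (i0 := i)).
- by apply/rowP=> j; rewrite !mxE eqxx !mxE mul1r.
- by apply/matrixP=> j k; rewrite !mxE [_ == i]eq_sym (negPf (neq_lift i j)) !mxE.
- by apply/matrixP=> j k; rewrite !mxE [_ == i]eq_sym (negPf (neq_lift i j)) !mxE.
Qed.
HB.instance Definition _ m n (e : 'M[R]_(m, n)) :=
  GRing.isLinear.Build R 'M[R]_(m, n) (ext R m n) *:%R (dwedge e) (dwedge_linear e).

End WedgeTheory.

Section DualMatrix.
Variable K : fieldType.
Local Notation D := (dual K).

Definition dual_mx m n (a b : 'M[K]_(m, n)) : 'M[D]_(m, n) :=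
  map_mx (in_alg D) a + eps *: map_mx (in_alg D) b.

Lemma dual_mxE m n (a b : 'M[K]_(m, n)) i j :
  dual_mx a b i j = (a i j)%:A + eps * (b i j)%:A.
Proof. by rewrite !mxE. Qed.

Lemma dual_mx_eq m n (B : 'M[D]_(m, n)) :
  B = dual_mx (map_mx (eps0 : D -> K) B) (map_mx (@eps1 K) B).
Proof. by apply/matrixP=> i j; rewrite dual_mxE !mxE -dual_eq. Qed.

Lemma dual_mx0 m n (a b : 'M[K]_(m, n)) : map_mx (eps0 : D -> K) (dual_mx a b) = a.
Proof.
apply/matrixP=> i j; rewrite mxE dual_mxE raddfD/= rmorphM/= eps0eps mul0r addr0.
exact: eps0C.
Qed.

Lemma dual_mx1 m n (a b : 'M[K]_(m, n)) : map_mx (@eps1 K) (dual_mx a b) = b.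
Proof.
by apply/matrixP=> i j; rewrite mxE dual_mxE raddfD/= eps1C eps1epsC add0r.
Qed.

Lemma dual_sum I (r : seq I) (F G : I -> K) :
  \sum_(i <- r) ((F i)%:A + eps * (G i)%:A) =
  (\sum_(i <- r) F i)%:A + eps * (\sum_(i <- r) G i)%:A :> D.
Proof. by rewrite big_split/= -mulr_sumr !scaler_suml. Qed.

Lemma dual_mxM m n p (a b : 'M[K]_(m, n)) (c d : 'M[K]_(n, p)) :
  dual_mx a b *m dual_mx c d = dual_mx (a *m c) (a *m d + b *m c).
Proof.
apply/matrixP=> i j; rewrite dual_mxE mxE.
under eq_bigr do rewrite !dual_mxE dual_mul.
by rewrite dual_sum !mxE -big_split.
Qed.

Lemma dual_mx_scalar m (a b : 'M[K]_m) : a = 1%:M -> b = 0 -> dual_mx a b = 1%:M.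
Proof.
move=> -> ->; apply/matrixP=> i j; rewrite dual_mxE !mxE scale0r mulr0 addr0.
by case: eqP; rewrite ?scale1r ?scale0r.
Qed.

Lemma dual_prod m (x y : 'I_m -> K) :
  \prod_i ((x i)%:A + eps * (y i)%:A) =
  (\prod_i x i)%:A + eps * (\sum_i \prod_j (if j == i then y j else x j))%:A :> D.
Proof.
elim: m x y => [|m IH] x y.
  by rewrite !big_ord0 scale0r mulr0 addr0 scale1r.
rewrite big_ord_recl IH dual_mul; congr (_ %:A + eps * _ %:A).
  by rewrite big_ord_recl.
rewrite [RHS]big_ord_recl addrC; congr (_ + _); first by rewrite [RHS]big_ord_recl eqxx.
rewrite mulr_sumr; apply: eq_bigr => i _; rewrite [RHS]big_ord_recl; congr (_ * _).
Qed.

Lemma dual_det m (a b : 'M[K]_m) :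
  \det (dual_mx a b) = (\det a)%:A + eps *
    (\sum_i \det (\matrix_j (if j == i then row j b else row j a)))%:A.
Proof.
rewrite /determinant exchange_big/= -dual_sum; apply: eq_bigr => s _.
under eq_bigr do rewrite dual_mxE.
rewrite dual_prod.
have -> : (-1) ^+ perm.odd_perm s = ((-1) ^+ perm.odd_perm s)%:A + eps * 0%:A :> D.
  by rewrite scale0r mulr0 addr0 -in_algE rmorphXn/= scaleN1r.
rewrite dual_mul mul0r addr0 mulr_sumr; congr (_ + eps * _ %:A).
apply: eq_bigr => i _; congr (_ * _); apply: eq_bigr => j _.
by rewrite !mxE; case: eqP => _; rewrite !mxE.
Qed.

Lemma dual_wedge m n (e f : 'M[K]_(m, n)) :
  wedge (dual_mx e f) = dual_mx (wedge e) (dwedge e f).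
Proof.
apply/rowP=> I; rewrite dual_mxE !mxE.
have -> : colsub (msubset_nth (enum_val I)) (dual_mx e f) =
    dual_mx (colsub (msubset_nth (enum_val I)) e) (colsub (msubset_nth (enum_val I)) f).
  by apply/matrixP=> i j; rewrite !mxE.
rewrite dual_det summxE; congr (_ + eps * _ %:A).
apply: eq_bigr => i _; rewrite mxE; congr (\det _).
by apply/matrixP=> j k; rewrite !mxE; case: eqP => _; rewrite !mxE.
Qed.

End DualMatrix.

Lemma ext_image_basis (K : fieldType) m n (R : comAlgType K) (B : 'M[R]_(m, n)) M :
  is_basis B M -> ext_image M = range (fun r : R => r *: wedge B).
Proof.
move=> [_ ->]; apply/seteqP; split.
  apply: lspan_min.
    split=> [|a _ _ [r _ <-] [r' _ <-]]; first by exists 0; rewrite ?scale0r.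
    by exists (a * r + r') => //; rewrite scalerDl scalerA.
  move=> _ [v [vB ->]].
  have {vB} /choice [c cP] i : exists c : 'rV[R]_m, c *m B = row i v.
    by have [c _ <-] := vB i; exists c.
  exists (\det (\matrix_i c i)) => //; rewrite -wedgeM; congr wedge.
  by apply/row_matrixP=> i; rewrite row_mul rowK cP.
move=> _ [r _ <-]; apply/lspanZ/lspan_gen; exists B; split=> // i.
by exists (delta_mx 0 i) => //; rewrite -rowE.
Qed.

Section Tangent.
Variables (K : fieldType) (m n : nat) (hmn : (m <= n)%N).
Local Notation D := (dual K).
Local Notation e := (std_frame K hmn).

Definition std_space : {vspace 'rV[K]_n} :=
  <<[tuple row i (std_frame K hmn) | i < m]>>%VS.

Lemma mem_std_space x : x \in std_space <-> exists c : 'rV[K]_m, x = c *m e.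
Proof.
split=> [/coord_span ->|[c ->]].
  exists (\row_i coord [tuple row i e | i < m] i x).
  rewrite mulmx_sum_row; apply: eq_bigr => i _; rewrite !mxE; congr (_ *: _).
  by rewrite -tnth_nth tnth_mktuple.
rewrite mulmx_sum_row; apply: memv_suml => i _; apply/memvZ/memv_span.
by apply/tnthP; exists i; rewrite tnth_mktuple.
Qed.

(* The rows are the vectors e_i + eps f_i. *)
Definition tangent_frame (f : 'M[K]_(m, n)) : 'M[D]_(m, n) := dual_mx e f.

Definition tangent_span (f : 'M[K]_(m, n)) : set 'rV[D]_n :=
  range (fun c : 'rV[D]_m => c *m tangent_frame f).

Let w : 'I_m -> 'I_n := widen_ord hmn.

Lemma std_frame_lead : colsub w e = 1%:M.
Proof.
apply/matrixP=> i j; rewrite !mxE/= -[RHS]/((i == j)%:R) eq_sym.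
by rewrite -!val_eqE.
Qed.

Definition tangent_inv f : 'M[D]_m := dual_mx 1%:M (- colsub w f).

Lemma tangent_lead f : colsub w (tangent_frame f) = dual_mx 1%:M (colsub w f).
Proof. by rewrite -std_frame_lead; apply/matrixP=> i j; rewrite !mxE. Qed.

Lemma tangent_leadK f : colsub w (tangent_frame f) *m tangent_inv f = 1%:M.
Proof.
rewrite tangent_lead dual_mxM; apply: dual_mx_scalar; rewrite ?mulmx1//.
by rewrite mul1mx addNr.
Qed.

Lemma colsubM p (R : comNzRingType) (c : 'M[R]_(p, m)) (B : 'M[R]_(m, n)) :
  colsub w (c *m B) = c *m colsub w B.
Proof. by apply/matrixP=> i j; rewrite !mxE; apply: eq_bigr=> k _; rewrite mxE. Qed.

Lemma tangent_frameK f p (c : 'M[D]_(p, m)) :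
  colsub w (c *m tangent_frame f) *m tangent_inv f = c.
Proof. by rewrite colsubM -mulmxA tangent_leadK mulmx1. Qed.

Lemma tangent_basis f : is_basis (tangent_frame f) (tangent_span f).
Proof. by split=> // c d /= cd; rewrite -[c](tangent_frameK f) cd tangent_frameK. Qed.

Lemma tangent_Gr f : Gr m (tangent_span f).
Proof.
split; first by exists (tangent_frame f); apply: tangent_basis.
exists [set x : 'rV[D]_n | colsub w x = 0]; split.
- split=> [|a u v /= u0 v0]; first by apply/rowP=> i; rewrite !mxE.
  rewrite -[LHS]/(colsub w (a *: u + v)).
  have -> : colsub w (a *: u + v) = a *: colsub w u + colsub w v.
    by apply/rowP=> i; rewrite !mxE.
  by rewrite u0 v0 scaler0 addr0.
- move=> _ [c _ <-] /= c0.
  by rewrite -[c](tangent_frameK f) c0 !mul0mx.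
move=> x; pose u := colsub w x *m tangent_inv f *m tangent_frame f.
exists u, (x - u); split; last by rewrite subrKC.
  by eexists.
rewrite /=; have -> : colsub w (x - u) = colsub w x - colsub w u.
  by apply/rowP=> i; rewrite !mxE.
by rewrite /u colsubM -mulmxA (mulmx1C (tangent_leadK f)) mulmx1 subrr.
Qed.

(* The K-rational point E; K^o is K as an algebra over itself. *)
Definition std_point : set 'rV[K^o]_n := [set x : 'rV[K]_n | x \in std_space].

Variable A : set 'M[K]_n.

Lemma std_point_ext_inv : @GrA K m n K^o A std_point -> ext_inv A (wedge e).
Proof.
move=> [_ [s [sA sE]]].
have : @ext_image K m n K^o std_point (wedge e).
  apply: lspan_gen; exists e; split=> // i; apply/mem_std_space.
  by exists (delta_mx 0 i); rewrite -rowE.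
rewrite sE => -[r _ <-]; apply: lspanZ.
exists [seq (p.1, wedge p.2) | p <- s]; split.
  by move=> _ /mapP[p /sA pA ->]; exists p.2.
rewrite big_map; apply: eq_bigr => p _; congr (_ *: _).
by apply/rowP=> I; rewrite mxE/= [_ *: _]mulr1.
Qed.

Lemma tangent_spanP (f : 'M[K]_(m, n)) M :
  is_basis (tangent_frame f) M -> M = tangent_span f.
Proof. by case. Qed.

Lemma ext_inv_lift x : ext_inv A x -> exists s : seq (K * 'M[K]_(m, n)),
  (forall p, p \in s -> inv_basis A p.2) /\ x = \sum_(p <- s) p.1 *: wedge p.2.
Proof.
move=> [s [sA ->]]; elim: s sA => [|[a v] s IH] sA; first by exists [::]; rewrite !big_nil.
have [q qs|t [tA tE]] := IH; first by apply: sA; rewrite inE qs orbT.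
have [/= y [yA ->]] := sA _ (mem_head _ _).
exists ((a, y) :: t); rewrite !big_cons tE; split=> // p.
by rewrite inE => /orP[/eqP->//|/tA].
Qed.

Lemma tangent_GrA f : ext_inv A (wedge e) -> ext_inv A (dwedge e f) ->
  GrA m A (tangent_span f).
Proof.
move=> /ext_inv_lift[s [sA sE]] /ext_inv_lift[t [tA tE]]; split; first exact: tangent_Gr.
exists ([seq (p.1%:A, p.2) | p <- s] ++ [seq (eps * p.1%:A, p.2) | p <- t]); split.
  by move=> p; rewrite mem_cat => /orP[/mapP[q /sA ? ->]|/mapP[q /tA ? ->]].
rewrite (ext_image_basis (tangent_basis f)) dual_wedge sE tE.
set x := dual_mx _ _; set y := \sum_(p <- _ ++ _) _.
suff -> : x = y by [].
rewrite /x /y /dual_mx big_cat !big_map. rewrite !raddf_sum/=.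
have scM (a b : K) : (a * b)%:A = a%:A * b%:A :> D by rewrite mulr_algl scalerA.
by congr (_ + _); apply: eq_bigr => p _; apply/rowP=> I; rewrite !mxE/= scM ?mulrA.
Qed.

Lemma tangent_pullback f : pullback (@eps0 K) (tangent_span f) = std_point.
Proof.
apply/seteqP; split.
  apply: lspan_min.
    split=> [|a u v uE vE]; first exact: mem0v.
    by apply: memvD vE; apply: memvZ.
  move=> _ [_ [c _ <-] <-]; apply/mem_std_space.
  exists (map_mx (eps0 : D -> K) c).
  by rewrite [LHS](@map_mxM _ _ (@eps0 K)); congr (_ *m _); exact: dual_mx0.
move=> x /mem_std_space[c ->]; apply: lspan_gen.
exists (dual_mx c 0 *m tangent_frame f); first by eexists.
by rewrite dual_mxM; exact: dual_mx0.
Qed.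

Lemma tangent_ext_inv f : GrA m A (tangent_span f) -> ext_inv A (dwedge e f).
Proof.
move=> [_ [s [sA]]]; rewrite (ext_image_basis (tangent_basis f)) dual_wedge => sE.
set W := dual_mx _ _ in sE.
have [r _ rW] : range (fun r : D => r *: \sum_(p <- s) p.1 *: map_mx (in_alg D) (wedge p.2)) W.
  by rewrite -sE; exists 1; rewrite ?scale1r.
have -> : dwedge e f = \sum_(p <- s) eps1 (r * p.1) *: wedge p.2.
  rewrite -[LHS](dual_mx1 (wedge e)) -/W -rW; apply/rowP=> I.
  rewrite !mxE !summxE mulr_sumr raddf_sum; apply: eq_bigr => p _.
  by rewrite !mxE/= mulrA mulr_algr linearZ/= mulrC.
exists [seq (eps1 (r * p.1), wedge p.2) | p <- s]; rewrite big_map; split=> //.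
by move=> _ /mapP[p /sA pA ->]; exists p.2.
Qed.

Lemma tangent_frame_exists (M : set 'rV[D]_n) : GrA m A M ->
  pullback (@eps0 K) M = std_point -> exists f, is_basis (tangent_frame f) M.
Proof.
move=> [[[B [Binj ME]] _] _] MK; pose B0 := map_mx (eps0 : D -> K) B.
have B0E : pullback (@eps0 K) M = range (fun c : 'rV[K]_m => c *m B0).
  apply/seteqP; split.
    apply: lspan_min.
      split=> [|a _ _ [c _ <-] [d _ <-]]; first by exists 0; rewrite ?mul0mx.
      by exists (a *: c + d) => //; rewrite mulmxDl -scalemxAl.
    move=> _ [x + <-]; rewrite ME => -[c _ <-].
    by exists (map_mx (eps0 : D -> K) c) => //; rewrite -[LHS](@map_mxM _ _ (@eps0 K)).
  move=> _ [c _ <-]; apply: lspan_gen; exists (dual_mx c 0 *m B).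
    by rewrite ME; eexists.
  by rewrite [LHS](@map_mxM _ _ (@eps0 K)); congr (_ *m _); exact: dual_mx0.
have /choice [P PE] i : exists c : 'rV[K]_m, c *m B0 = row i e.
  have : std_point (row i e).
    by apply/mem_std_space; exists (delta_mx 0 i); rewrite -rowE.
  by rewrite -MK B0E => -[c _ <-]; exists c.
have /choice [Q QE] i : exists c : 'rV[K]_m, row i B0 = c *m e.
  apply/mem_std_space; have : std_point (row i B0); last by [].
  by rewrite -MK B0E; exists (delta_mx 0 i); rewrite -?rowE.
pose PM := \matrix_i P i; pose QM := \matrix_i Q i.
have PB : PM *m B0 = e by apply/row_matrixP=> i; rewrite row_mul rowK PE.
have QB : QM *m e = B0 by apply/row_matrixP=> i; rewrite row_mul rowK QE.
have PQ : PM *m QM = 1%:M.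
  by rewrite -[LHS]mulmx1 -(std_frame_lead) -colsubM -mulmxA QB PB.
have QP := mulmx1C PQ.
exists (map_mx (@eps1 K) (dual_mx PM 0 *m B)).
have -> : tangent_frame (map_mx (@eps1 K) (dual_mx PM 0 *m B)) = dual_mx PM 0 *m B.
  rewrite [RHS]dual_mx_eq; congr dual_mx; rewrite -PB.
  by rewrite [RHS](@map_mxM _ _ (@eps0 K)); congr (_ *m _); rewrite [RHS]dual_mx0.
have PQd : dual_mx PM 0 *m dual_mx QM 0 = 1%:M.
  by rewrite dual_mxM mulmx0 mul0mx addr0; apply: dual_mx_scalar.
have QPd := mulmx1C PQd.
split.
  move=> c d /=; rewrite !mulmxA => /Binj cd.
  by rewrite -[c]mulmx1 -PQd mulmxA cd -mulmxA PQd mulmx1.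
rewrite ME; apply/seteqP; split=> _ [c _ <-].
  by exists (c *m dual_mx QM 0) => //; rewrite mulmxA -(mulmxA c) QPd mulmx1.
by exists (c *m dual_mx PM 0) => //; rewrite mulmxA.
Qed.

Lemma tangent_span_eq f g : tangent_span f = tangent_span g <->
  exists X : 'M[K]_m, f = g + X *m e.
Proof.
split=> [fg|[X ->]].
  have /choice [C CE] i : exists c : 'rV[D]_m, c *m tangent_frame g = row i (tangent_frame f).
    suff : tangent_span g (row i (tangent_frame f)) by move=> [c _ <-]; exists c.
    by rewrite -fg; exists (delta_mx 0 i); rewrite -?rowE.
  pose CM := \matrix_i C i.
  have CB : CM *m tangent_frame g = tangent_frame f.
    by apply/row_matrixP=> i; rewrite row_mul rowK CE.
  move: CB; rewrite [CM]dual_mx_eq dual_mxM; set c0 := map_mx _ _; set c1 := map_mx _ _.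
  move=> CB; have := congr1 (map_mx (eps0 : D -> K)) CB; rewrite [X in X = _]dual_mx0 [X in _ = X]dual_mx0 => c0e.
  have c01 : c0 = 1%:M.
    by rewrite -[c0]mulmx1 -std_frame_lead -colsubM c0e.
  have := congr1 (map_mx (@eps1 K)) CB; rewrite [X in X = _]dual_mx1 [X in _ = X]dual_mx1 c01 mul1mx => <-.
  by exists c1.
have XE : tangent_frame (g + X *m e) = dual_mx 1%:M X *m tangent_frame g.
  by rewrite dual_mxM !mul1mx.
have X1 : dual_mx 1%:M (- X) *m dual_mx 1%:M X = 1%:M.
  by rewrite dual_mxM; apply: dual_mx_scalar; rewrite !mul1mx ?mulmx1 ?addrN.
rewrite /tangent_span XE; apply/seteqP; split=> _ [c _ <-].
  by exists (c *m dual_mx 1%:M X) => //; rewrite mulmxA.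
by exists (c *m dual_mx 1%:M (- X)) => //; rewrite mulmxA -(mulmxA c) X1 mulmx1.
Qed.

End Tangent.

Section TangentSpace.
Variables (K : fieldType) (m n : nat) (hmn : (m <= n)%N) (A : set 'M[K]_n).
Local Notation e := (std_frame K hmn).
Local Notation E := (std_point hmn).

Record tangent_space (hE : GrA m A E) := TangentSpace {
  tangent_val :> set 'rV[dual K]_n;
  tangent_valP : GrA m A tangent_val /\ pullback (@eps0 K) tangent_val = E
}.

HB.instance Definition _ hE := gen_eqMixin (tangent_space hE).
HB.instance Definition _ hE := gen_choiceMixin (tangent_space hE).

Variable hE : GrA m A E.
Local Notation T := (tangent_space hE).
Implicit Types (M N : T) (f g : 'M[K]_(m, n)).

Lemma tangent_val_inj M N : M = N :> set _ -> M = N.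
Proof.
by case: M N => [M hM] [N hN] /= MN; subst N; congr TangentSpace; apply: Prop_irrelevance.
Qed.

Fact tangent_coord_subproof M : exists f, is_basis (tangent_frame hmn f) M.
Proof. by have [hA hK] := tangent_valP M; apply: tangent_frame_exists hA hK. Qed.

(* Some f such that M has basis (e_i + eps f_i); f is determined modulo E. *)
Definition tangent_coord M : 'M[K]_(m, n) := sval (cid (tangent_coord_subproof M)).

Lemma tangent_coordK M : tangent_span hmn (tangent_coord M) = M.
Proof. by apply/esym/tangent_spanP; exact: svalP (cid (tangent_coord_subproof M)). Qed.

Definition liftable : set 'M[K]_(m, n) := [set f | ext_inv A (dwedge e f)].

Lemma tangent_coordP M : liftable (tangent_coord M).
Proof.
by apply: tangent_ext_inv; rewrite tangent_coordK; have [] := tangent_valP M.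
Qed.

Lemma liftableP a f g : liftable f -> liftable g -> liftable (a *: f + g).
Proof. by move=> hf hg; rewrite /liftable/= linearP; apply: lspanP. Qed.

Lemma liftable0 : liftable 0.
Proof. by rewrite /liftable/= raddf0; apply: lspan0. Qed.

Lemma liftableZ a f : liftable f -> liftable (a *: f).
Proof. by move=> hf; rewrite -[_ *: _]addr0; apply: liftableP liftable0. Qed.

Lemma liftableD f g : liftable f -> liftable g -> liftable (f + g).
Proof. by move=> hf hg; rewrite -[f]scale1r; apply: liftableP. Qed.

Lemma tangent_of_subproof f : liftable f ->
  GrA m A (tangent_span hmn f) /\ pullback (@eps0 K) (tangent_span hmn f) = E.
Proof.
move=> hf; split; last exact: tangent_pullback.
exact: tangent_GrA (std_point_ext_inv hE) hf.
Qed.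

Definition tangent_of f (hf : liftable f) : T := TangentSpace hE (tangent_of_subproof hf).

(* M + N has basis (e_i + eps (f_i + g_i)) and a *: M has basis
   (e_i + eps (a f_i)) whenever M, N have bases (e_i + eps f_i) and
   (e_i + eps g_i); see tangent_lincomb for independence of the choice. *)
Definition tangent_add M N : T :=
  tangent_of (liftableD (tangent_coordP M) (tangent_coordP N)).
Definition tangent_scale a M : T := tangent_of (liftableZ a (tangent_coordP M)).
Definition tangent_zero : T := tangent_of liftable0.
Definition tangent_opp M : T := tangent_scale (-1) M.

Lemma tangent_span_lin a f f' g g' :
  tangent_span hmn f = tangent_span hmn f' -> tangent_span hmn g = tangent_span hmn g' ->
  tangent_span hmn (a *: f + g) = tangent_span hmn (a *: f' + g').
Proof.
move=> /tangent_span_eq[X ->] /tangent_span_eq[Y ->].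
apply/tangent_span_eq; exists (a *: X + Y).
by rewrite scalerDr addrACA mulmxDl scalemxAl.
Qed.

Lemma tangent_addE M N f g :
  M = tangent_span hmn f :> set _ -> N = tangent_span hmn g :> set _ ->
  tangent_add M N = tangent_span hmn (f + g) :> set _.
Proof.
move=> Mf Ng; rewrite /= -[tangent_coord M]scale1r -[f]scale1r.
by apply: tangent_span_lin; rewrite tangent_coordK.
Qed.

Lemma tangent_scaleE a M f : M = tangent_span hmn f :> set _ ->
  tangent_scale a M = tangent_span hmn (a *: f) :> set _.
Proof.
move=> Mf; have /= := tangent_span_lin a (etrans (tangent_coordK M) Mf) (erefl (tangent_span hmn 0)).
by rewrite !addr0.
Qed.

Let tcK M : M = tangent_span hmn (tangent_coord M) :> set _.
Proof. by rewrite tangent_coordK. Qed.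

Fact tangent_addA : associative tangent_add.
Proof.
move=> M N P; apply: tangent_val_inj.
rewrite (tangent_addE (tcK M) (tangent_addE (tcK N) (tcK P))) addrA.
by rewrite (tangent_addE (tangent_addE (tcK M) (tcK N)) (tcK P)).
Qed.

Fact tangent_addC : commutative tangent_add.
Proof. by move=> M N; apply: tangent_val_inj; rewrite /= addrC. Qed.

Fact tangent_add0 : left_id tangent_zero tangent_add.
Proof.
move=> M; apply: tangent_val_inj.
rewrite (@tangent_addE tangent_zero M 0 _ (erefl _) (tcK M)) add0r.
exact: tangent_coordK.
Qed.

Fact tangent_addN : left_inverse tangent_zero tangent_opp tangent_add.
Proof.
move=> M; apply: tangent_val_inj.
by rewrite (tangent_addE (tangent_scaleE (-1) (tcK M)) (tcK M)) scaleN1r addNr.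
Qed.

HB.instance Definition _ := GRing.isZmodule.Build T
  tangent_addA tangent_addC tangent_add0 tangent_addN.

Fact tangent_scaleA a b M : tangent_scale a (tangent_scale b M) = tangent_scale (a * b) M.
Proof.
apply: tangent_val_inj; rewrite (tangent_scaleE _ (tangent_scaleE b (tcK M))).
by rewrite (tangent_scaleE _ (tcK M)) scalerA.
Qed.

Fact tangent_scale1 : left_id 1 tangent_scale.
Proof. by move=> M; apply: tangent_val_inj; rewrite /= scale1r; exact: tangent_coordK. Qed.

Fact tangent_scaleDr : right_distributive tangent_scale +%R.
Proof.
move=> a M N; apply: tangent_val_inj.
rewrite (tangent_scaleE a (tangent_addE (tcK M) (tcK N))) scalerDr.
by rewrite (tangent_addE (tangent_scaleE a (tcK M)) (tangent_scaleE a (tcK N))).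
Qed.

Fact tangent_scaleDl M : {morph tangent_scale^~ M : a b / a + b}.
Proof.
move=> a b; apply: tangent_val_inj.
rewrite (tangent_scaleE _ (tcK M)) scalerDl.
by rewrite (tangent_addE (tangent_scaleE a (tcK M)) (tangent_scaleE b (tcK M))).
Qed.

HB.instance Definition _ := GRing.Zmodule_isLmodule.Build K T
  tangent_scaleA tangent_scale1 tangent_scaleDr tangent_scaleDl.

Lemma tangent_lincomb (a b : K) M N f g :
  is_basis (tangent_frame hmn f) M -> is_basis (tangent_frame hmn g) N ->
  is_basis (tangent_frame hmn (a *: f + b *: g)) (a *: M + b *: N : T).
Proof.
move=> /tangent_spanP Mf /tangent_spanP Ng.
have := tangent_addE (tangent_scaleE a Mf) (tangent_scaleE b Ng).
rewrite -[tangent_add _ _]/(a *: M + b *: N : T) => ->.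
exact: tangent_basis.
Qed.

End TangentSpace.

Section SE.
Variables (K : fieldType) (m n : nat) (hmn : (m <= n)%N).
Local Notation e := (std_frame K hmn).
Local Notation E := (std_space K hmn).

(* The m-th exterior power of E, which over a field embeds in that of K^n as
   the line spanned by e_1 /\ ... /\ e_m. *)
Definition ext_top : {vspace ext K m n} := <[wedge e]>%VS.

Definition ext_der_fun (psi : 'Hom(subvs_of E, 'rV[K]_n)) (x : subvs_of ext_top) :
    ext K m n :=
  coord [tuple wedge e] ord0 (vsval x) *:
    dwedge e (\matrix_(i < m) psi (vsproj E (row i e))).

Fact ext_der_fun_linear psi : linear (ext_der_fun psi).
Proof. by move=> a x y; rewrite /ext_der_fun !linearP/= scalerDl scalerA. Qed.
HB.instance Definition _ psi := GRing.isLinear.Build K (subvs_of ext_top) (ext K m n)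
  *:%R (ext_der_fun psi) (ext_der_fun_linear psi).

Definition ext_der (psi : 'Hom(subvs_of E, 'rV[K]_n)) :
    'Hom(subvs_of ext_top, ext K m n) :=
  linfun (ext_der_fun psi).

Fact ext_der_linear : linear ext_der.
Proof.
move=> a f g; apply/lfunP=> x; rewrite !lfunE/= lfunE/= !lfunE/= /ext_der_fun.
rewrite [a *: (_ *: _)]scalerA mulrC -scalerA -scalerDr -linearP; congr (_ *: dwedge _ _).
by apply/row_matrixP=> i; rewrite linearP/= !rowK lfunE/= lfunE.
Qed.
HB.instance Definition _ := GRing.isLinear.Build K 'Hom(subvs_of E, 'rV[K]_n)
  'Hom(subvs_of ext_top, ext K m n) *:%R ext_der ext_der_linear.

Lemma wedge_std_neq0 : wedge e != 0.
Proof.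
have sI : #|[set widen_ord hmn i | i : 'I_m]%SET| == m.
  by rewrite card_imset ?card_ord// => i j /(congr1 val)/= /val_inj.
pose I : msubset m n := exist (fun J : {set 'I_n} => #|J| == m) _ sI.
apply/eqP => /rowP/(_ (enum_rank I)); rewrite !mxE enum_rankK => /eqP.
apply/negP; rewrite -unitfE -[_ \is a _]/(_ \in unitmx).
set B := colsub _ _; suff BB : B *m B^T = 1%:M by have [] := mulmx1_unit BB.
have nI (i : 'I_m) : exists j, msubset_nth I j = widen_ord hmn i.
  have iI : widen_ord hmn i \in val I by apply: imset_f.
  exists (cast_ord (eqP (valP I)) (enum_rank_in iI (widen_ord hmn i))).
  by rewrite /msubset_nth cast_ordK enum_rankK_in.
have nJ : injective (msubset_nth I).
  by move=> j k /enum_val_inj /cast_ord_inj.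
apply/matrixP=> i k; have [j0 j0E] := nI i.
rewrite !mxE (bigD1 j0)//= big1 => [|j jj0]; rewrite !mxE/=.
  by rewrite j0E !eqxx !mulr_natl addr0 mulr1n; congr (_%:R); rewrite -!val_eqE.
rewrite (_ : (msubset_nth I j == _) = false) ?mul0r//.
by apply: contraNF jj0 => /eqP; rewrite -j0E => /nJ->.
Qed.

Lemma ext_derE psi : ext_der psi (vsproj ext_top (wedge e)) =
  dwedge e (\matrix_(i < m) psi (vsproj E (row i e))).
Proof.
rewrite lfunE/= /ext_der_fun vsprojK ?memv_line//.
have fr : free [tuple wedge e] by rewrite seq1_free wedge_std_neq0.
by rewrite (coord_free ord0 ord0 fr) eqxx scale1r.
Qed.

Variables (A : set 'M[K]_n) (L : {vspace 'rV[K]_n}).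

(* Hom(E, L) viewed in Hom(E, K^n). *)
Definition hom_incl (psi : 'Hom(subvs_of E, subvs_of L)) : 'Hom(subvs_of E, 'rV[K]_n) :=
  (linfun vsval \o psi)%VF.

Definition S_pred : {pred 'Hom(subvs_of E, subvs_of L)} :=
  fun psi => `[< forall w, w \in limg (ext_der (hom_incl psi)) -> ext_inv A w >].

Fact S_submod_closed : submod_closed S_pred.
Proof.
have inE psi : reflect (forall x, ext_inv A (ext_der (hom_incl psi) x)) (psi \in S_pred).
  apply: (iffP (asboolP _)) => [h x|h w /memv_imgP[x _ ->]//]; apply: h.
  exact: memv_img (memvf _).
have inclP : linear hom_incl.
  by move=> a f g; apply/lfunP=> x; rewrite !lfunE/= !lfunE/= !lfunE/= lfunE.
split=> [|a f g /inE hf /inE hg]; apply/inE => x.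
  suff -> : hom_incl 0 = 0 by rewrite linear0 lfunE; apply: lspan0.
  by apply/lfunP=> y; rewrite !lfunE/= lfunE /= lfunE.
by rewrite inclP linearP lfunE/= lfunE/=; apply: lspanP; [exact: hf|exact: hg].
Qed.
HB.instance Definition _ := GRing.isSubmodClosed.Build K 'Hom(subvs_of E, subvs_of L)
  S_pred (GRing.submod_closed_semi S_submod_closed).

Record S_space : predArgType := SSpace { S_val :> 'Hom(subvs_of E, subvs_of L); _ : S_val \in S_pred }.
HB.instance Definition _ := [isSub for S_val].
HB.instance Definition _ := [Choice of S_space by <:].
HB.instance Definition _ := [SubChoice_isSubLmodule of S_space by <:].

End SE.

(* Main.v *)
Require Import Defs.
From HB Require Import structures.
From mathcomp Require Import all_boot all_order all_algebra.
From mathcomp Require Import boolp classical_sets.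

Import GRing.Theory.
Local Open Scope ring_scope.

(** A tangent vector at [E] is a matrix [f] of first-order terms, taken modulo
    matrices with rows in [E]; composing with the projection onto [L] along [E]
    picks out a unique representative with rows in [L], that is, an element of
    [Hom(E, L)].  The first-order coefficient of the wedge of the frame
    [e_i + eps f_i] is [dwedge e f], which is the value of [d psi] on the
    generator [e_1 /\ ... /\ e_m]; so being generated by invariants to first
    order is exactly the condition defining [S_E]. *)

Section Coordinates.
Context {K : fieldType} {m n : nat} (hmn : (m <= n)%N).
Local Notation e := (std_frame K hmn).
Local Notation E := (std_space K hmn).
Implicit Types f g : 'M[K]_(m, n).

Lemma row_std_frame_mem i : row i e \in E.
Proof. by apply/mem_std_space; exists (delta_mx 0 i); rewrite -rowE. Qed.

(** The leading [m] columns of [e] form the identity, so the first [m] entries of a vector of [E]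
    are its coordinates in the basis [e_i]. *)
Lemma std_space_leadK (x : 'rV[K]_n) :
  x \in E -> colsub (widen_ord hmn) x *m e = x.
Proof. by move=> /mem_std_space[c ->]; rewrite colsubM std_frame_lead mulmx1. Qed.

Lemma rows_in_std_space f : (forall i, row i f \in E) -> exists X : 'M_m, f = X *m e.
Proof.
move=> fE; exists (colsub (widen_ord hmn) f); apply/row_matrixP => i.
rewrite row_mul -[LHS](std_space_leadK _ (fE i)); congr (_ *m _).
by apply/rowP => j; rewrite !mxE.
Qed.

Section Complement.
Variable L : {vspace 'rV[K]_n}.
Hypothesis hsum : (E + L)%VS = fullv.
Hypothesis hcap : (E :&: L)%VS = 0%VS.

Let hcap' : (L :&: E)%VS = 0%VS. Proof. by rewrite capvC. Qed.

(** [colsub] reads off the coordinates of [x] in the basis [e_i]; thus [e_i] goes to the projection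
    of row [i] of [f] onto [L] along [E]. *)
Definition hom_fun f (x : subvs_of E) : subvs_of L :=
  vsproj L (daddv_pi L E (colsub (widen_ord hmn) (vsval x) *m f)).

Lemma hom_fun_linear f : linear (hom_fun f).
Proof.
move=> a x y; rewrite /hom_fun -!linearP scalemxAl -mulmxDl linearP/=.
by congr (vsproj L (daddv_pi L E (_ *m f))); apply/rowP => j; rewrite !mxE.
Qed.
HB.instance Definition _ f := GRing.isLinear.Build K (subvs_of E) (subvs_of L)
  *:%R (hom_fun f) (hom_fun_linear f).

Definition hom_of_mx f : 'Hom(subvs_of E, subvs_of L) := linfun (hom_fun f).

Definition mx_of_hom (psi : 'Hom(subvs_of E, subvs_of L)) : 'M[K]_(m, n) :=
  \matrix_i vsval (psi (vsproj E (row i e))).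

Lemma hom_of_mx_linear : linear hom_of_mx.
Proof.
move=> a f g; apply/lfunP => x; rewrite !lfunE/= !lfunE/= lfunE/= /hom_fun.
by rewrite mulmxDr -scalemxAr !linearP.
Qed.

(** As [E] and [L] are complementary, this difference is the projection of [x] onto [E]. *)
Lemma daddv_pi_std x : x - daddv_pi L E x \in E.
Proof.
have := daddv_pi_add hcap' (w := x); rewrite addvC hsum memvf.
by move=> /(_ isT)/(canRL (addKr _)); rewrite addrC => <-; rewrite memv_pi.
Qed.

Lemma daddv_pi_std0 x : x \in E -> daddv_pi L E x = 0.
Proof.
move=> xE; apply/eqP; rewrite -memv0 -hcap memv_cap memv_pi andbT.
by rewrite -[daddv_pi _ _ _](subKr x) memvB ?daddv_pi_std.
Qed.

(** The rows of [X *m e] lie in [E], which the projection kills; hence [hom_of_mx] is well defined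
    on tangent vectors. *)
Lemma hom_of_mx_std f X : hom_of_mx (f + X *m e) = hom_of_mx f.
Proof.
apply/lfunP => x; rewrite !lfunE/= /hom_fun mulmxDr linearD/=.
rewrite [X in _ + X]daddv_pi_std0 ?addr0//; apply/mem_std_space.
by exists (colsub (widen_ord hmn) (vsval x) *m X); rewrite mulmxA.
Qed.

Lemma hom_of_mxE f i :
  vsval (hom_of_mx f (vsproj E (row i e))) = daddv_pi L E (row i f).
Proof.
rewrite lfunE/= /hom_fun !vsprojK ?memv_pi ?row_std_frame_mem//.
rewrite (_ : colsub _ _ = row i (colsub (widen_ord hmn) e)).
  by rewrite std_frame_lead -row_mul mul1mx.
by apply/rowP => j; rewrite !mxE.
Qed.

Lemma mx_of_homK : cancel mx_of_hom hom_of_mx.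
Proof.
move=> psi; apply/lfunP => x; rewrite -(vsvalK x).
have /mem_std_space[c ->] := subvsP x.
rewrite mulmx_sum_row !linear_sum/=; apply: eq_bigr => i _.
rewrite !linearZ/=; congr (_ *: _); apply/val_inj/etrans; first exact: hom_of_mxE.
(* The values of [psi] already lie in [L], so the projection fixes them. *)
by rewrite rowK (daddv_pi_id hcap') ?subvsP.
Qed.

(** Projecting loses only the [E]-components of the rows; [X] holds their coordinates. *)
Lemma hom_of_mxK f : exists X : 'M_m, f = mx_of_hom (hom_of_mx f) + X *m e.
Proof.
have [i|X fX] := @rows_in_std_space (f - mx_of_hom (hom_of_mx f)).
  by rewrite linearB/= rowK hom_of_mxE daddv_pi_std.
by exists X; rewrite -fX addrC subrK.
Qed.

End Complement.

(** The top exterior power of [E] is the line through [wedge e], so testing the image of [d psi] on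
    this one generator suffices. *)
Lemma S_predE (A : set 'M[K]_n) (L : {vspace 'rV[K]_n})
    (psi : 'Hom(subvs_of E, subvs_of L)) :
  psi \in S_pred A (L:=L) <-> liftable hmn A (mx_of_hom L psi).
Proof.
have dE : dwedge e (mx_of_hom L psi) =
    ext_der (hom_incl psi) (vsproj (ext_top K hmn) (wedge e)).
  rewrite ext_derE; congr dwedge; apply/row_matrixP => i.
  by rewrite !rowK lfunE/= lfunE.
split=> [/asboolP h|h].
  by rewrite /liftable/= dE; apply/h/memv_img/memvf.
apply/asboolP => _ /memv_imgP[x _ ->].
have /vlineP[c xc] := subvsP x.
have -> : x = c *: vsproj (ext_top K hmn) (wedge e) by rewrite -(vsvalK x) xc linearZ.
by rewrite linearZ; apply: lspanZ; move: h; rewrite /liftable/= dE.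
Qed.

Section Tangent.
Variables (A : set 'M[K]_n) (hE : GrA m A (std_point hmn)).

(* Both conditions say that the point with basis [e_i + eps f_i] is generated
   by invariants, and this point only depends on [f] modulo [E]. *)
Lemma liftable_std f (X : 'M[K]_m) : liftable hmn A (f + X *m e) <-> liftable hmn A f.
Proof.
have sp : tangent_span hmn (f + X *m e) = tangent_span hmn f.
  by apply/tangent_span_eq; exists X.
by split=> /(tangent_of_subproof hE)[h _]; apply: tangent_ext_inv;
  [rewrite -sp|rewrite sp].
Qed.

Lemma tangent_coord_of f (hf : liftable hmn A f) :
  exists X : 'M[K]_m, tangent_coord (tangent_of hE hf) = f + X *m e.
Proof. by apply/tangent_span_eq; rewrite tangent_coordK. Qed.

End Tangent.
End Coordinates.

Theorem theorem3p6 (k K : fieldType) (iota : {rmorphism k -> K}) (m n : nat)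
  (A : set 'M[K]_n) (hA : is_subalgebra iota A)
  (hmn : (m <= n)%N) (hE : GrA m A (std_point hmn))
  (L : {vspace 'rV[K]_n})
  (hsum : (std_space K hmn + L)%VS = fullv)
  (hcap : (std_space K hmn :&: L)%VS = 0%VS) :
  exists phi : {linear tangent_space hE -> S_space hmn A L}, bijective phi.
Proof.
pose h (M : tangent_space hE) := hom_of_mx hmn L (tangent_coord M).
have hS M : h M \in S_pred A (L:=L).
  have [X MX] := hom_of_mxK hmn L hsum hcap (tangent_coord M).
  apply/S_predE/(liftable_std hmn A hE _ X); rewrite -MX; exact: tangent_coordP.
pose phi M := SSpace (hS M).
have phi_linear : linear phi.
  move=> a M N; apply: val_inj; rewrite linearP/= /h -hom_of_mx_linear.
  (* [tangent_coord] is a choice, hence linear only modulo [E], which is enough since [hom_of_mx]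
     ignores that ambiguity. *)
  have [X ->] : exists X : 'M[K]_m, tangent_coord (a *: M + N) =
      a *: tangent_coord M + tangent_coord N + X *m std_frame K hmn.
    apply/tangent_span_eq; rewrite tangent_coordK.
    apply: tangent_addE; last by rewrite tangent_coordK.
    by apply: tangent_scaleE; rewrite tangent_coordK.
  exact: hom_of_mx_std.
pose phiL : {linear tangent_space hE -> S_space hmn A L} := HB.pack phi
  (GRing.isLinear.Build K _ _ *:%R phi phi_linear).
exists phiL.
have hT (psi : S_space hmn A L) : liftable hmn A (mx_of_hom hmn L psi).
  by apply/S_predE; exact: valP psi.
(* The inverse sends [psi] to the point with basis [e_i + eps psi(e_i)]. *)
exists (fun psi => tangent_of hE (hT psi)) => [M|psi].
  apply: tangent_val_inj; rewrite -[RHS]tangent_coordK; apply/esym/tangent_span_eq.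
  exact: hom_of_mxK.
apply: val_inj; rewrite /= /h.
have [X ->] := tangent_coord_of hmn A hE _ (hT psi).
by rewrite hom_of_mx_std// mx_of_homK.
Qed.
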